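(* Let $\Omega\subset\mathbb{R}^3$ be a smoothly bounded connected domain and let $\boldsymbol{w}\in C^\infty(\overline{\Omega})$ be a smooth non-vanishing vector field in $\Omega$. For $u,v\in C^1_0(\Omega)$ set $(u,v)_\perp=\int_\Omega \nabla_\perp u\cdot\nabla_\perp v\,dV$ and $\|\nabla_\perp u\|^2=(u,u)_\perp$. 1. If $h=\boldsymbol{w}\cdot\nabla\times\boldsymbol{w}\neq 0$ (at every point of $\Omega$), then the bilinear form $(u,v)_\perp$ satisfies the axioms of an inner product on $C^1_0(\Omega)$; hence $\|\nabla_\perp u\|$ is a norm on $C^1_0(\Omega)$. 2. Under the same condition $h\ne0$, the function space $C^1_0(\Omega)$ equipped with the norm $\|\nabla_\perp u\|$ is a pre-Hilbert space, and it can be completed to a Hilbert space $\mathcal{H}^\perp_0(\Omega)$.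
   Context: Functions are real valued. ''Smoothly bounded domain'' means a bounded domain with smooth boundary $\partial\Omega$. With $w=|\boldsymbol{w}|$, the orthogonal gradient of $u$ with respect to $\boldsymbol{w}$ is $\nabla_\perp u=\dfrac{\boldsymbol{w}\times(\nabla u\times\boldsymbol{w})}{w^2}$, i.e. the component of $\nabla u$ orthogonal to $\boldsymbol{w}$. $C^1_0(\Omega)$ denotes the space of $C^1$ functions on $\overline{\Omega}$ vanishing on $\partial\Omega$. *)

(* Defs.v *)
From HB Require Import structures.
From mathcomp Require Import all_boot all_order all_algebra.
From mathcomp Require Import all_classical all_reals all_analysis.

Set Implicit Arguments.
Unset Strict Implicit.
Unset Printing Implicit Defensive.
Import Order.TTheory GRing.Theory Num.Theory.
Import numFieldNormedType.Exports.
Local Open Scope classical_set_scope.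
Local Open Scope ring_scope.

Section VectorCalculus.
Context {R : realType}.
Implicit Types (a b : 'rV[R]_3) (f u v : 'rV[R]_3 -> R).
Implicit Types (w : 'rV[R]_3 -> 'rV[R]_3) (D U Omega : set 'rV[R]_3).

Definition row3 (x y z : R) : 'rV[R]_3 := \row_(i < 3) [:: x; y; z]`_i.

Definition dotv a b : R := \sum_(i < 3) a 0 i * b 0 i.

Definition crossv a b : 'rV[R]_3 :=
  row3 (a 0 1 * b 0 2 - a 0 2 * b 0 1)
       (a 0 2 * b 0 0 - a 0 0 * b 0 2)
       (a 0 0 * b 0 1 - a 0 1 * b 0 0).

Definition partial (i : 'I_3) f : 'rV[R]_3 -> R :=
  fun x => 'D_(delta_mx 0 i) f x.

Definition iter_partial (s : seq 'I_3) f : 'rV[R]_3 -> R := foldr partial f s.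

Definition component (i : 'I_3) w : 'rV[R]_3 -> R := fun x => w x 0 i.

Definition grad f : 'rV[R]_3 -> 'rV[R]_3 := fun x => \row_i partial i f x.

Definition curl w : 'rV[R]_3 -> 'rV[R]_3 := fun x =>
  row3 (partial 1 (component 2 w) x - partial 2 (component 1 w) x)
       (partial 2 (component 0 w) x - partial 0 (component 2 w) x)
       (partial 0 (component 1 w) x - partial 1 (component 0 w) x).

Definition helicity w : 'rV[R]_3 -> R := fun x => dotv (w x) (curl w x).

Definition grad_perp w f : 'rV[R]_3 -> 'rV[R]_3 := fun x =>
  (dotv (w x) (w x))^-1 *: crossv (w x) (crossv (grad f x) (w x)).

(* Lebesgue measure lives on the product R * R * R, not on row vectors, so the
   volume integral is transported along the coordinate isomorphism. *)
Definition vol_int D f : R :=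
  \int[((@lebesgue_measure R \x @lebesgue_measure R)
          \x @lebesgue_measure R)%E]_(p in [set p | D (row3 p.1.1 p.1.2 p.2)])
    f (row3 p.1.1 p.1.2 p.2).

Definition perp_form Omega w u v : R :=
  vol_int Omega (fun x => dotv (grad_perp w u x) (grad_perp w v x)).

Definition perp_norm Omega w u : R := Num.sqrt (perp_form Omega w u u).

(* C^oo on an open set U: all iterated partial derivatives exist and are
   continuous on U. *)
Definition smooth_on U f : Prop := forall s : seq 'I_3,
  (forall x, U x -> {for x, continuous (iter_partial s f)}) /\
  (forall i x, U x -> derivable (iter_partial s f) x (delta_mx 0 i)).

(* C^k on the closure of an open set Omega: f is continuous on the closure, is
   C^k in Omega, and its partial derivatives of order at most k extend
   continuously from Omega to the closure. *)
Definition Ck_closure (k : nat) Omega f : Prop :=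
  {within closure Omega, continuous f} /\
  forall s : seq 'I_3,
    ((size s < k)%N -> forall i x, Omega x ->
       derivable (iter_partial s f) x (delta_mx 0 i)) /\
    ((size s <= k)%N -> exists2 g : 'rV[R]_3 -> R,
       {within closure Omega, continuous g} &
       forall x, Omega x -> g x = iter_partial s f x).

Definition smooth_field_closure Omega w : Prop :=
  forall k i, Ck_closure k Omega (component i w).

(* Near each boundary point, Omega is the negativity set of a smooth function
   with non-vanishing gradient. *)
Definition smooth_boundary Omega : Prop :=
  forall p, (closure Omega `\` interior Omega) p ->
    exists (U : set 'rV[R]_3) (phi : 'rV[R]_3 -> R),
      [/\ open U, U p, smooth_on U phi,
          forall x, U x -> grad phi x != 0 &
          forall x, U x -> (Omega x <-> phi x < 0)].

Definition smoothly_bounded_domain Omega : Prop :=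
  [/\ Omega !=set0, open Omega, connected Omega, bounded_set Omega &
      smooth_boundary Omega].

(* A function on the closure vanishing on the boundary is represented by its
   extension by zero to the whole space, so that equality in C10 is equality
   of functions on the closure. *)
Definition C10_pred Omega : {pred 'rV[R]_3 -> R} :=
  mem [set u | Ck_closure 1 Omega u /\ forall x, ~ Omega x -> u x = 0].

End VectorCalculus.

Section C10Space.
Context {R : realType} (Omega : set 'rV[R]_3).

Fact C10_submod_closed : submod_closed (C10_pred Omega).
Proof.
split.
  rewrite inE; split; last by [].
  have dE s : iter_partial s (0 : 'rV[R]_3 -> R) = 0.
    elim: s => //= i s ->; apply/funext => x.
    by rewrite /partial -[0]/(cst 0) derive_cst.
  split; first by apply: continuous_subspaceT => x; exact: cst_continuous.
  move=> s; rewrite dE; split=> [_ i x _|_].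
    exact: (@derivable_cst _ _ _ (0 : R)).
  exists (cst 0) => //.
  by apply: continuous_subspaceT => x; exact: cst_continuous.
move=> a u v; rewrite !inE => -[[uC uD] u0] [[vC vD] v0].
have lin (f g : 'rV[R]_3 -> R) : {within closure Omega, continuous f} ->
    {within closure Omega, continuous g} ->
    {within closure Omega, continuous (a *: f + g)}.
  move=> fC gC x; apply: continuousD; last exact: gC.
  by apply: continuousM; [exact: cst_continuous|exact: fC].
split; last first.
  by move=> x Ox; rewrite fctE /= -[(a *: u) x]/(a * u x) u0// v0// mulr0 addr0.
split; first exact: lin.
case=> [|i [|j s]]; last by split=> /=; rewrite ?ltnS ?ltn0.
  split=> [_ i x Ox|_]; last by exists (a *: u + v) => //; exact: lin.
  have [/(_ isT) ud _] := uD [::]; have [/(_ isT) vd _] := vD [::].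
  by apply: derivableD; [apply: derivableZ; exact: ud|exact: vd].
split=> // _.
have [_ /(_ isT)[gu guC guE]] := uD [:: i].
have [_ /(_ isT)[gv gvC gvE]] := vD [:: i].
exists (a *: gu + gv); first exact: lin.
move=> x Ox /=.
have [/(_ isT) ud _] := uD [::]; have [/(_ isT) vd _] := vD [::].
rewrite /partial deriveD; [|by apply: derivableZ; exact: ud|exact: vd].
rewrite deriveZ; last exact: ud.
by congr (_ *: _ + _); [exact: guE|exact: gvE].
Qed.

HB.instance Definition _ := GRing.isSubmodClosed.Build R ('rV[R]_3 -> R)
  (C10_pred Omega) C10_submod_closed.

Record C10 := MkC10 {
  C10_fun :> 'rV[R]_3 -> R;
  C10_funP : C10_fun \in C10_pred Omega
}.

HB.instance Definition _ := [isSub for C10_fun].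
HB.instance Definition _ := [Choice of C10 by <:].
HB.instance Definition _ := [SubChoice_isSubLmodule of C10 by <:].

End C10Space.

Section HilbertSpaces.
Context {R : realType}.

Definition is_inner_product (V : lmodType R) (B : V -> V -> R) : Prop :=
  exists D : {dot V for @idfun R}, forall u v, D u v = B u v.

Definition is_norm (V : lmodType R) (N : V -> R) : Prop :=
  [/\ forall u, 0 <= N u,
      forall u, N u = 0 -> u = 0,
      forall (a : R) u, N (a *: u) = `|a| * N u &
      forall u v, N (u + v) <= N u + N v].

Definition is_prehilbert (V : lmodType R) (N : V -> R) (B : V -> V -> R) : Prop :=
  is_inner_product B /\ forall u, N u = Num.sqrt (B u u).

(* H is a Hilbert space for the inner product BH, which induces its (complete)
   norm, and iota embeds (V, B) isometrically onto a dense subspace of H. *)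
Definition is_hilbert_completion (V : lmodType R) (B : V -> V -> R)
    (H : completeNormedModType R) (BH : H -> H -> R) (iota : {linear V -> H}) :
    Prop :=
  [/\ is_prehilbert (fun x : H => `|x|) BH,
      forall u v, BH (iota u) (iota v) = B u v &
      dense (range iota)].

End HilbertSpaces.

(* Main.v *)
Require Import Defs.
From HB Require Import structures.
From mathcomp Require Import all_boot all_order all_algebra.
From mathcomp Require Import all_classical all_reals all_analysis.
From mathcomp Require Import ring lra.
Set Implicit Arguments.
Unset Strict Implicit.
Unset Printing Implicit Defensive.
Import Order.TTheory GRing.Theory Num.Theory.
Import numFieldNormedType.Exports.
Local Open Scope classical_set_scope.
Local Open Scope ring_scope.

(** The point is positive definiteness, and this is where the helicity enters.
If the form vanishes at [u], its integrand, which is nonnegative,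
continuous on [Omega] and bounded, vanishes identically
([vol_int_eq0]), so [grad u = lam w] on [Omega] with [lam] continuous.  For a
function [u] of class C^2 one would take the curl and pair with [w], which gives
[lam * helicity w = 0]; but [u] is only C^1 and [lam] only continuous.  The
substitute is the symmetry of second derivatives at a single point [p]: for a
direction [a] orthogonal to [w p], the derivative ['D_a u = lam (w . a)] is a
continuous function times a differentiable function vanishing at [p], hence is
differentiable at [p] with gradient [lam p] times that of [w . a]
([has_gradientM0]).  For two such directions [a], [b], both mixed second
derivatives are the limit of the same second difference quotient of [u]
([mixed_derivatives]), and the equality reads
[lam p * (curl w p . (a x b)) = 0].  Since products [a x b] give every multiple
of [w p], this forces [lam p = 0] ([grad_parallel_eq0]).  Finally a function
with zero gradient is constant along a ray up to the first point where the ray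
leaves [Omega]; there it vanishes by continuity ([const_gradient_eq0]).

The completion is realised inside the space of functions [V -> R]: it consists
of the functionals that are limits, in operator norm, of functionals [B v].
A limit of such functionals is again one, so completeness comes from that of
the real numbers, and equality of elements is equality of functions, without any
quotient of Cauchy sequences.  The inner product is defined by polarization of
the operator norm, and its bilinearity follows from that of [B] by density
([polar_cvg]). *)

(** * Inner products and norms *)

Lemma is_inner_productP (R : realType) (V : lmodType R) (B : V -> V -> R) :
  (forall u v, B u v = B v u) ->
  (forall a u u' v, B (a *: u + u') v = a * B u v + B u' v) ->
  (forall u, u != 0 -> 0 < B u u) ->
  is_inner_product B.
Proof.
move=> Bsym Blin Bpos.
have Bbil : bilinear_for (GRing.Scale.Law.clone _ _ *%R _)
                         (GRing.Scale.Law.clone _ _ (idfun \; *%R) _) B.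
  split=> [v a u u'|u a v v'] /=; first exact: Blin.
  by rewrite Bsym Blin (Bsym v) (Bsym v').
pose BB := bilinear_isBilinear.Build R V V R _ _ B Bbil.
pose BS := isHermitianSesquilinear.Build R V false (@idfun R) B
  (fun u v => etrans (Bsym u v) (esym (etrans (mul1r _) (congr1 idfun erefl)))).
pose BD := isDotProduct.Build R V B Bpos.
pose D : {dot V for @idfun R} := HB.pack B BB BS BD.
by exists D.
Qed.

Section SeminormFromForm.
Context {R : realType} {V : lmodType R} (B : {dot V for @idfun R}).

Definition form_norm (u : V) : R := Num.sqrt (B u u).

Lemma dot_formC u v : B u v = B v u.
Proof. by rewrite (hermitian_subproof u v) expr0 mul1r. Qed.

Lemma dot_form_ge0 u : 0 <= B u u.
Proof.
have [->|u0] := eqVneq u 0; first by rewrite linear0l.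
exact/ltW/neq0_dnorm_gt0.
Qed.

Lemma form_norm_ge0 u : 0 <= form_norm u.
Proof. exact: sqrtr_ge0. Qed.

Lemma sqr_form_norm u : form_norm u ^+ 2 = B u u.
Proof. by rewrite sqr_sqrtr// dot_form_ge0. Qed.

Lemma form_norm_eq0 u : form_norm u = 0 -> u = 0.
Proof.
move=> u0; apply/eqP; apply/negPn/negP => /(neq0_dnorm_gt0 (s:=B)).
by rewrite -sqr_form_norm u0 expr0n ltxx.
Qed.

Lemma dot_formZl a u v : B (a *: u) v = a * B u v.
Proof. exact: linearZl_LR. Qed.

Lemma dot_formZr a u v : B u (a *: v) = a * B u v.
Proof. by rewrite dot_formC dot_formZl dot_formC. Qed.

Lemma dot_form_sqrD u v : B (u + v) (u + v) = B u u + 2 * B u v + B v v.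
Proof. by rewrite linearDl !linearDr /= (dot_formC v u); ring. Qed.

Lemma cauchy_schwarz u v : `|B u v| <= form_norm u * form_norm v.
Proof.
have [->|v0] := eqVneq v 0.
  by rewrite linear0r normr0 mulr_ge0 ?form_norm_ge0.
have vp : 0 < B v v by exact: neq0_dnorm_gt0.
(* B v v times the component of u orthogonal to v *)
have : 0 <= B (B v v *: u - B u v *: v) (B v v *: u - B u v *: v).
  exact: dot_form_ge0.
rewrite linearBl !linearBr /= !(dot_formZl, dot_formZr) (dot_formC v u).
rewrite [X in 0 <= X -> _](_ : _ = B v v * (B u u * B v v - B u v ^+ 2)); last by ring.
rewrite pmulr_rge0// subr_ge0 -!sqr_form_norm -exprMn => le2.
rewrite -(@ler_pXn2r _ 2)// ?nnegrE ?mulr_ge0 ?form_norm_ge0//.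
by rewrite -normrX ger0_norm// sqr_ge0.
Qed.


Lemma form_normZ a u : form_norm (a *: u) = `|a| * form_norm u.
Proof.
by rewrite /form_norm dot_formZl dot_formZr mulrA -expr2 sqrtrM ?sqr_ge0// sqrtr_sqr.
Qed.

Lemma form_normD u v : form_norm (u + v) <= form_norm u + form_norm v.
Proof.
rewrite -(@ler_pXn2r _ 2)// ?nnegrE ?addr_ge0 ?form_norm_ge0//.
rewrite sqr_form_norm dot_form_sqrD sqrrD !sqr_form_norm lerD2r lerD2l.
rewrite -[leRHS]mulr_natl ler_pM2l//.
exact: le_trans (ler_norm _) (cauchy_schwarz u v).
Qed.

End SeminormFromForm.

(** * Completion of an inner product space *)

Section Completion.
Context {R : realType} {V : lmodType R} (B : {dot V for @idfun R}).
Local Notation N := (form_norm B).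

(** The closure of the functionals [B v] in operator norm, phrased without that
norm. *)
Definition approximable : {pred V -> R} :=
  mem [set f : V -> R | forall e, 0 < e ->
    exists v, forall y, `|f y - B v y| <= e * N y].

Fact approximable_submod_closed : submod_closed approximable.
Proof.
split=> [|a f g]; rewrite !inE/=.
  move=> e e0; exists 0 => y.
  by rewrite linear0l subrr normr0 mulr_ge0 ?form_norm_ge0// ltW.
move=> fB gB e e0.
have a0 : 0 < `|a| + 1 by rewrite ltr_wpDl.
have [v fv] := fB (e / 2 / (`|a| + 1)) ltac:(by rewrite !divr_gt0).
have [w gw] := gB (e / 2) ltac:(by rewrite divr_gt0).
exists (a *: v + w) => y.
rewrite linearDl /= dot_formZl -[(a *: f + g) y]/(a * f y + g y).
rewrite (_ : _ - _ = a * (f y - B v y) + (g y - B w y)); last by ring.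
rewrite (le_trans (ler_normD _ _))// (splitr e) mulrDl lerD//.
rewrite normrM; apply: (@le_trans _ _ ((`|a| + 1) * (e / 2 / (`|a| + 1) * N y))).
  by apply: ler_pM => //; rewrite lerDl.
by rewrite mulrA [_ * (_ / _)]mulrC divfK// gt_eqF.
Qed.

HB.instance Definition _ := GRing.isSubmodClosed.Build R (V -> R)
  approximable approximable_submod_closed.

Record completion := MkCompletion {
  completion_fun :> V -> R;
  completion_funP : completion_fun \in approximable
}.

HB.instance Definition _ := [isSub for completion_fun].
HB.instance Definition _ := [Choice of completion by <:].
HB.instance Definition _ := [SubChoice_isSubLmodule of completion by <:].

Implicit Types f g : completion.

Let bounds f : set R := [set c | 0 <= c /\ forall y, `|f y| <= c * N y].

(** The operator norm as the least constant [c] with [`|f y| <= c * N y], so that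
an upper bound on it is a family of pointwise estimates. *)
Definition op_norm f : R := inf (bounds f).

Lemma completionD f g y : (f + g) y = f y + g y. Proof. by []. Qed.
Lemma completionZ a f y : (a *: f) y = a * f y. Proof. by []. Qed.

Let bounds_has_inf f : has_inf (bounds f).
Proof.
split; last by exists 0 => c [].
have := completion_funP f; rewrite inE => /(_ 1 ltr01)[v fv].
exists (1 + N v); split => [|y]; first by rewrite addr_ge0// form_norm_ge0.
rewrite -[f y](subrK (B v y)) (le_trans (ler_normD _ _))// mulrDl lerD//.
exact: cauchy_schwarz.
Qed.

Lemma op_norm_ge0 f : 0 <= op_norm f.
Proof. by apply: lb_le_inf; [case: (bounds_has_inf f)|move=> c []]. Qed.

Lemma op_norm_bound f y : `|f y| <= op_norm f * N y.
Proof.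
have := form_norm_ge0 B y; rewrite le_eqVlt => /predU1P[Ny|Ny].
  have [[c [_ fc]] _] := bounds_has_inf f.
  by have := fc y; rewrite -Ny !mulr0.
rewrite -ler_pdivrMr//; apply: lb_le_inf; first by case: (bounds_has_inf f).
by move=> c [_ cf]; rewrite /= ler_pdivrMr.
Qed.

Lemma op_norm_le f c : 0 <= c -> (forall y, `|f y| <= c * N y) -> op_norm f <= c.
Proof. by move=> c0 fc; apply: ge_inf => //; case: (bounds_has_inf f). Qed.

Fact op_normD f g : op_norm (f + g) <= op_norm f + op_norm g.
Proof.
apply: op_norm_le => [|y]; first by rewrite addr_ge0 ?op_norm_ge0.
by rewrite completionD mulrDl (le_trans (ler_normD _ _))// lerD ?op_norm_bound.
Qed.

Let op_normZ_le a f : op_norm (a *: f) <= `|a| * op_norm f.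
Proof.
apply: op_norm_le => [|y]; first by rewrite mulr_ge0 ?op_norm_ge0.
by rewrite completionZ normrM -mulrA ler_wpM2l ?op_norm_bound.
Qed.

Fact op_normZ a f : op_norm (a *: f) = `|a| * op_norm f.
Proof.
apply/eqP; rewrite eq_le op_normZ_le /=.
have [->|a0] := eqVneq a 0; first by rewrite normr0 mul0r op_norm_ge0.
rewrite -ler_pdivlMl ?normr_gt0//.
by rewrite (le_trans _ (le_trans (op_normZ_le a^-1 (a *: f)) _))//
  ?normfV// scalerA mulVf// scale1r.
Qed.

Fact op_norm_eq0 f : op_norm f = 0 -> f = 0.
Proof.
move=> f0; apply/val_inj/funext => y /=.
by have := op_norm_bound f y; rewrite f0 mul0r normr_le0 => /eqP.
Qed.

HB.instance Definition _ :=
  Lmodule_isNormed.Build R completion op_normD op_normZ op_norm_eq0.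

Lemma completion_normE f : `|f| = op_norm f. Proof. by []. Qed.

End Completion.

Section CompletionComplete.
Context {R : realType} {V : lmodType R} (B : {dot V for @idfun R}).
Local Notation N := (form_norm B).
Local Notation H := (completion B).
Implicit Types f g : H.

Lemma completion_bound f g y : `|f y - g y| <= `|f - g| * N y.
Proof. exact: (op_norm_bound (f - g) y). Qed.

(** A Cauchy filter converges pointwise because the reals are complete; the
Cauchy bounds pass to the limit uniformly in the argument, so that the pointwise
limit is approximable and is the limit in norm. *)
Fact completion_complete (F : set_system H) :
  ProperFilter F -> cauchy F -> cvg F.
Proof.
move=> FF /cauchyP Fc.
have near_ball e : 0 < e -> exists f, \forall g \near F, `|f - g| <= e.
  move=> /Fc[f Ff]; exists f; apply: filterS Ff => g.
  by rewrite -ball_normE /= => /ltW.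
have Fpt y : cvg ((fun f : H => f y) @ F).
  apply: cauchy_cvg; apply/cauchyP => e e0.
  have Ny0 : 0 < N y + 1 by rewrite ltr_wpDl// form_norm_ge0.
  have [f Ff] := near_ball (e / (N y + 1)) (divr_gt0 e0 Ny0).
  exists (f y); apply: (filterS _ Ff) => g fg; rewrite -ball_normE /=.
  apply: (@le_lt_trans _ _ (e / (N y + 1) * N y)).
    apply: le_trans (completion_bound f g y) _.
    by rewrite ler_wpM2r ?form_norm_ge0.
  by rewrite mulrAC ltr_pdivrMr// ltr_pM2l// ltrDl.
pose l y : R := lim ((fun f : H => f y) @ F).
have l_near e f : (\forall g \near F, `|f - g| <= e) ->
    forall y, `|f y - l y| <= e * N y.
  move=> Ff y.
  apply: (@cvgr_to_le _ F _ _ (fun g : H => `|f y - g y|)).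
    by apply: cvg_norm; apply: cvgB; [exact: cvg_cst|exact: Fpt].
  apply: filterS Ff => g fg; apply: le_trans (completion_bound f g y) _.
  by rewrite ler_wpM2r ?form_norm_ge0.
have lB : l \in approximable B.
  rewrite inE /= => e e0; have e2 : 0 < e / 2 by rewrite divr_gt0.
  have [f Ff] := near_ball (e / 2) e2.
  have := completion_funP f; rewrite inE => /(_ (e / 2) e2)[v fv].
  exists v => y; rewrite -(subrK (f y) (l y)) -addrA (le_trans (ler_normD _ _))//.
  by rewrite (splitr e) mulrDl lerD// distrC l_near.
apply/cvg_ex; exists (MkCompletion lB).
apply/cvgrPdist_le => /= e e0; have e2 : 0 < e / 2 by rewrite divr_gt0.
have [f Ff] := near_ball (e / 2) e2.
near=> g; rewrite -(subrK f (MkCompletion lB)) -addrA (splitr e).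
rewrite (le_trans (ler_normD _ _))// lerD//; last by near: g.
rewrite completion_normE; apply: op_norm_le => [|y]; first exact: ltW.
by rewrite -normrN opprB /= l_near.
Unshelve. all: by end_near. Qed.

HB.instance Definition _ := Uniform_isComplete.Build H completion_complete.

Fact riesz_in_completion (v : V) : (B v : V -> R) \in approximable B.
Proof.
rewrite inE /= => e e0; exists v => y.
by rewrite subrr normr0 mulr_ge0 ?form_norm_ge0// ltW.
Qed.

(** The embedding of [V] as in the Riesz representation. *)
Definition riesz v : H := MkCompletion (riesz_in_completion v).

Fact riesz_linear : linear riesz.
Proof.
move=> a u v; apply/val_inj/funext => y /=.
by rewrite linearDl /= dot_formZl.
Qed.

HB.instance Definition _ := GRing.isLinear.Build R V H _ riesz riesz_linear.

Lemma riesz_isometry v : `|riesz v| = N v.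
Proof.
rewrite completion_normE; apply/eqP; rewrite eq_le; apply/andP; split.
  by apply: op_norm_le => [|y]; [exact: form_norm_ge0|exact: cauchy_schwarz].
have := op_norm_bound (riesz v) v.
rewrite /= -sqr_form_norm ger0_norm ?sqr_ge0// expr2.
have [->|Nv] := eqVneq (N v) 0; first by rewrite op_norm_ge0.
by rewrite ler_pM2r// lt_neqAle eq_sym Nv form_norm_ge0.
Qed.

Lemma riesz_approx f : exists x : nat -> V, riesz (x n) @[n --> \oo] --> f.
Proof.
have /choice[x fx] : forall n : nat, exists v, `|f - riesz v| <= n.+1%:R^-1.
  move=> n; have := completion_funP f; rewrite inE.
  move=> /(_ n.+1%:R^-1 ltac:(by rewrite invr_gt0))[v fv]; exists v.
  by rewrite completion_normE; apply: op_norm_le => // y; exact: fv.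
exists x; apply/cvgrPdist_le => /= e e0; near=> n.
apply: le_trans (fx n) _; apply: ltW; near: n.
exact: near_infty_natSinv_lt (PosNum e0).
Unshelve. all: by end_near. Qed.

Lemma riesz_dense : dense (range riesz).
Proof.
move=> O [f Of] oO; have [x xf] := riesz_approx f.
have : \forall n \near \oo, O (riesz (x n)).
  by apply: xf; exact: open_nbhs_nbhs.
by move=> [n _ /(_ n (leqnn n)) Oxn]; exists (riesz (x n)); split => //; exists (x n).
Qed.

(** The only possible inner product inducing the norm, by polarization. *)
Definition polar f g : R := 4^-1 * (`|f + g| ^+ 2 - `|f - g| ^+ 2).

(** Polarization is continuous and agrees with [B] on the image of [V]; through
this limit every algebraic identity of [B] extends to the completion. *)
Lemma polar_cvg (x y : nat -> V) f g :
  riesz (x n) @[n --> \oo] --> f -> riesz (y n) @[n --> \oo] --> g ->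
  B (x n) (y n) @[n --> \oo] --> polar f g.
Proof.
move=> xf yg.
have -> : (fun n => B (x n) (y n)) =
    (fun n => polar (riesz (x n)) (riesz (y n))).
  apply/funext => n; rewrite /polar -linearD -linearB !riesz_isometry.
  rewrite !sqr_form_norm -scaleN1r !dot_form_sqrD !(dot_formZl, dot_formZr).
  by field.
rewrite /polar; apply: cvgM; first exact: cvg_cst.
by apply: cvgB; apply: cvgM; apply: cvg_norm;
  do [exact: (cvgD xf yg)|exact: (cvgB xf yg)].
Qed.

Lemma polar_riesz u v : polar (riesz u) (riesz v) = B u v.
Proof.
apply/esym/(@cvg_unique _ (@Rhausdorff R) _ _ (B u v) _ (@cvg_cst _ _ nat \oo _)).
exact: (@polar_cvg (fun=> u) (fun=> v) _ _ (@cvg_cst _ _ _ _ _) (@cvg_cst _ _ _ _ _)).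
Qed.

Lemma polar_inner_product : is_inner_product polar.
Proof.
apply: is_inner_productP => [f g|a f f' g|f f0].
- by rewrite /polar (addrC f) (distrC f).
- have [x xf] := riesz_approx f; have [x' xf'] := riesz_approx f'.
  have [y yg] := riesz_approx g.
  have xx' : riesz (a *: x n + x' n) @[n --> \oo] --> a *: f + f'.
    under eq_fun do rewrite linearP.
    by apply: cvgD => //; apply: cvgZr.
  apply: (@cvg_unique _ (@Rhausdorff R) _ _ _ _ (polar_cvg xx' yg)).
  have -> : (fun n => B (a *: x n + x' n) (y n)) =
      (fun n => a * B (x n) (y n) + B (x' n) (y n)).
    by apply/funext => n; rewrite linearDl /= dot_formZl.
  by apply: cvgD; [apply: cvgM; [exact: cvg_cst|]|]; exact: polar_cvg.
- rewrite /polar subrr normr0 expr0n subr0 mulr_gt0// exprn_gt0// normr_gt0.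
  by rewrite -mulr2n -scaler_nat scaler_eq0 pnatr_eq0.
Qed.

Lemma hilbert_completion :
  is_hilbert_completion (B : V -> V -> R) polar riesz.
Proof.
split; [split|exact: polar_riesz|exact: riesz_dense].
  exact: polar_inner_product.
move=> f; have ff : `|f + f| = 2 * `|f|.
  by rewrite -mulr2n -scaler_nat normrZ ger0_norm.
rewrite /polar ff subrr normr0 expr0n subr0 exprMn -natrX mulrA.
by rewrite mulVf ?pnatr_eq0// mul1r sqrtr_sqr normr_id.
Qed.

End CompletionComplete.

(** * Mean values along segments *)

Section Segments.
Context {R : realType} {V : normedModType R}.
Implicit Types (f : V -> R) (p v : V).

Lemma is_derive_line f p v t : derivable f (p + t *: v) v ->
  is_derive t 1 (fun s : R => f (p + s *: v)) ('D_v f (p + t *: v)).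
Proof.
pose df (h : R) := h^-1 *: (f (h *: v + (p + t *: v)) - f (p + t *: v)).
have E : (fun h : R => h^-1 *: (f (p + (h *: 1 + t) *: v) - f (p + t *: v))) = df.
  by apply/funext => h; rewrite [h *: 1]mulr1 scalerDl addrCA.
by move=> fd; apply: DeriveDef; rewrite /derivable /derive /= E.
Qed.

Lemma is_derive_scale f p v (c : R) : derivable f p v ->
  is_derive p (c *: v) f (c * 'D_v f p).
Proof.
move=> fd.
have fd' : is_derive (0 * c) 1 (fun s : R => f (p + s *: v)) ('D_v f p).
  rewrite mul0r; have := @is_derive_line f p v 0.
  by rewrite scale0r addr0; apply.
have mc : is_derive (0 : R) 1 (fun s : R => s * c) c.
  have := is_deriveM (is_derive_id (0 : R) 1) (is_derive_cst c (0 : R) 1).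
  by rewrite scaler0 add0r [c *: _]mulr1.
have := @is_derive1_comp _ (fun s : R => f (p + s *: v)) (fun s : R => s * c) 0 _ _ fd' mc.
move=> [dd de].
have E : (fun h : R => h^-1 *: (f (h *: (c *: v) + p) - f p)) =
   (fun h : R => h^-1 *: (((fun s : R => f (p + s *: v)) \o (fun s : R => s * c)) (h *: 1 + 0) -
     ((fun s : R => f (p + s *: v)) \o (fun s : R => s * c)) 0)).
  apply/funext => h /=; rewrite addr0 [h *: 1]mulr1 mul0r scale0r addr0.
  by rewrite scalerA (addrC p).
apply: DeriveDef; first by rewrite /derivable /= E.
by rewrite [RHS]mulrC -de /derive /= E.
Qed.

Lemma segment_MVT f p v : (forall t : R, 0 <= t <= 1 -> derivable f (p + t *: v) v) ->
  exists2 t, 0 <= t <= 1 & f (p + v) - f p = 'D_v f (p + t *: v).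
Proof.
move=> fd.
have fd1 (t : R) : 0 <= t <= 1 ->
    is_derive t 1 (fun s : R => f (p + s *: v)) ('D_v f (p + t *: v)).
  by move=> t01; exact/is_derive_line/fd.
have [t t01 E] : exists2 t, t \in `[0, 1]%R & f (p + 1 *: v) - f (p + 0 *: v) =
    'D_v f (p + t *: v) * (1 - 0).
  apply: (@MVT_segment R (fun s : R => f (p + s *: v))) => //.
    by move=> t; rewrite in_itv/= => /andP[/ltW ? /ltW ?]; apply: fd1; apply/andP.
  apply: derivable_within_continuous => t; rewrite in_itv/= => t01.
  by have [] := fd1 t t01.
exists t; first by move: t01; rewrite in_itv.
by move: E; rewrite scale1r scale0r addr0 subr0 mulr1.
Qed.

End Segments.

(** * First-order expansions and symmetry of second derivatives *)

Section Gradient.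
Context {R : realType}.
Local Notation V3 := 'rV[R]_3.
Implicit Types (f g psi : V3 -> R) (p a b c k : V3) (i : 'I_3).

Lemma ler_coord_norm n (x : 'rV[R]_n) (i : 'I_n) : `|x 0 i| <= `|x|.
Proof.
rewrite [leRHS]/Num.norm /= mx_normrE.
exact: (le_bigmax _ (fun ij => `|x ij.1 ij.2|) (0, i)).
Qed.

Lemma row_norm_le n (x : 'rV[R]_n) (e : R) :
  0 <= e -> (forall i : 'I_n, `|x 0 i| <= e) -> `|x| <= e.
Proof.
move=> e0 xe; rewrite [leLHS]/Num.norm /= mx_normrE.
by apply/bigmax_leP; split => // -[i j] _ /=; rewrite ord1.
Qed.

Lemma dotvE a b : dotv a b = a 0 0 * b 0 0 + a 0 1 * b 0 1 + a 0 2 * b 0 2.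
Proof.
rewrite /dotv !big_ord_recl big_ord0 addr0 addrA.
by congr (_ + _ * _ + _ * _); congr (_ 0 _); exact/val_inj.
Qed.

Lemma dotvC a b : dotv a b = dotv b a.
Proof. by rewrite !dotvE; ring. Qed.

Lemma dotvDr a b c : dotv a (b + c) = dotv a b + dotv a c.
Proof. by rewrite !dotvE !mxE; ring. Qed.

Lemma dotvZr (s : R) a b : dotv a (s *: b) = s * dotv a b.
Proof. by rewrite !dotvE !mxE; ring. Qed.

Lemma dotvBr a b c : dotv a (b - c) = dotv a b - dotv a c.
Proof. by rewrite !dotvE !mxE; ring. Qed.

Lemma dotvZl (s : R) a b : dotv (s *: a) b = s * dotv a b.
Proof. by rewrite dotvC dotvZr dotvC. Qed.

Lemma dotv_bound c k : `|dotv c k| <= (\sum_i `|c 0 i|) * `|k|.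
Proof.
rewrite /dotv (le_trans (ler_norm_sum _ _ _))// mulr_suml.
by apply: ler_sum => i _; rewrite normrM ler_wpM2l// ler_coord_norm.
Qed.

(** Frechet differentiability of [f] at [p] with gradient [c], written with
explicit bounds; it gets applied to derivatives ['D_a f], which are known to
have such an expansion at the single point [p]. *)
Definition has_gradient f p c := forall e, 0 < e ->
  \forall k \near (0 : V3), `|f (p + k) - f p - dotv c k| <= e * `|k|.

(** Reach [p + k] from [p] one coordinate at a time; each step is a mean value of
one partial derivative at a point within [`|k|] of [p]. *)
Lemma C1_has_gradient f p :
  (forall i, \forall x \near p, derivable f x (delta_mx 0 i)) ->
  (forall i, {for p, continuous (partial i f)}) ->
  has_gradient f p (grad f p).
Proof.
move=> fd fC e e0.
have e3 : 0 < e / 3 by rewrite divr_gt0.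
have /nbhs_ballP[d /= d0 dP] : \forall x \near p, forall i, derivable f x (delta_mx 0 i) /\
    `|partial i f p - partial i f x| <= e / 3.
  apply: (@filter_forall _ _ (fun i x => derivable f x (delta_mx 0 i) /\
    `|partial i f p - partial i f x| <= e / 3) (nbhs p) (@nbhs_filter _ p)) => i.
  apply: filterI; first exact: fd.
  by move: (fC i) => /cvgrPdist_le; apply.
apply/nbhs_ballP; exists d => //= k; rewrite -ball_normE /= sub0r normrN => kd.
(* the increment k truncated to its first j coordinates *)
pose r (j : nat) : V3 := \row_i (if (i < j)%N then k 0 i else 0).
have rS i : r i.+1 = r i + k 0 i *: delta_mx 0 i.
  apply/rowP => j; rewrite !mxE eqxx /= ltnS leq_eqVlt -val_eqE /=.
  by case: ltngtP => [||/val_inj->] /=; rewrite ?mulr0 ?mulr1 ?addr0 ?add0r.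
have step i : `|f (p + r i.+1) - f (p + r i) - grad f p 0 i * k 0 i| <= e / 3 * `|k|.
  have inB t : 0 <= t <= 1 -> ball p d (p + r i + t *: (k 0 i *: delta_mx 0 i)).
    move=> /andP[t0 t1]; rewrite -ball_normE /= -addrA opprD addNKr normrN.
    apply: le_lt_trans kd; apply: row_norm_le => // j; rewrite !mxE eqxx /= -val_eqE /=.
    case: ltngtP => [_|_|_].
    - by rewrite !mulr0 addr0 ler_coord_norm.
    - by rewrite !mulr0 addr0 normr0.
    - rewrite add0r mulr1 normrM ger0_norm// -[leRHS]mul1r.
      by rewrite ler_pM// ler_coord_norm.
  rewrite rS addrA; have [t t01 ->] :=
    @segment_MVT R V3 f (p + r i) (k 0 i *: delta_mx 0 i) (fun t t01 =>
      let D := is_derive_scale (k 0 i) (dP _ (inB t t01) i).1 in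
      @ex_derive _ _ _ _ _ _ _ D).
  have [fxd fxC] := dP _ (inB t t01) i.
  have [_ ->] := is_derive_scale (k 0 i) fxd.
  rewrite mxE mulrC -mulrBl normrM ler_pM//; first by rewrite distrC.
  exact: ler_coord_norm.
have -> : f (p + k) - f p - dotv (grad f p) k =
    \sum_(i < 3) (f (p + r i.+1) - f (p + r i) - grad f p 0 i * k 0 i).
  rewrite big_split /= sumrN; congr (_ - _).
  rewrite -(big_mkord xpredT (fun i : nat => f (p + r i.+1) - f (p + r i))).
  rewrite telescope_sumr//; congr (f _ - f _).
    by congr (_ + _); apply/rowP => i; rewrite mxE ltn_ord.
  by rewrite -[LHS]addr0; congr (_ + _); apply/rowP => i; rewrite !mxE.
rewrite (le_trans (ler_norm_sum _ _ _))//.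
rewrite (le_trans (ler_sum _ (fun i _ => step i)))// sumr_const card_ord.
by rewrite -[leLHS]mulr_natr [leLHS]mulrAC divfK// pnatr_eq0.
Qed.

Lemma has_gradient_derive f p c a : has_gradient f p c ->
  is_derive p a f (dotv c a).
Proof.
move=> fc.
have lim_a : (fun h : R => h^-1 *: (f (h *: a + p) - f p)) @ 0^' --> dotv c a.
  apply/cvgrPdist_le => /= e e0.
  have a0 : 0 < `|a| + 1 by rewrite ltr_wpDl.
  have /nbhs_ballP[d /= d0 dP] := fc _ (divr_gt0 e0 a0).
  near=> h.
  have h0 : h != 0 by near: h; exact: nbhs_dnbhs_neq.
  have hd : `|h| < d / (`|a| + 1).
    by near: h; apply: dnbhs0_lt; exact: divr_gt0.
  have hab : `|h *: a| <= `|h| * (`|a| + 1) by rewrite normrZ ler_wpM2l// lerDl.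
  have : ball (0 : V3) d (h *: a).
    rewrite -ball_normE /= sub0r normrN (le_lt_trans hab)//.
    by rewrite -ltr_pdivlMr.
  move=> /dP; rewrite dotvZr (addrC p) => le_h.
  rewrite (_ : _ - _ = - h^-1 * (f (h *: a + p) - f p - h * dotv c a)); last first.
    by rewrite /GRing.scale /=; field.
  rewrite normrM normrN normfV mulrC ler_pdivrMr ?normr_gt0//.
  apply: (le_trans le_h); apply: (le_trans (ler_wpM2l _ hab)).
    by rewrite ltW// divr_gt0.
  by rewrite mulrCA divfK ?gt_eqF// mulrC.
apply: DeriveDef; first by apply/cvg_ex; exists (dotv c a).
exact: (cvg_lim _ lim_a).
Unshelve. all: by end_near. Qed.

Lemma is_derive_translate f x z v (l : R) :
  is_derive (x + z) v f l -> is_derive x v (fun q => f (q + z)) l.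
Proof.
move=> [fd fl]; have E : (fun h : R => h^-1 *: (f (h *: v + x + z) - f (x + z))) =
    (fun h : R => h^-1 *: (f (h *: v + (x + z)) - f (x + z))).
  by apply/funext => h; rewrite addrA.
by apply: DeriveDef; rewrite -?fl /derivable /derive /= E.
Qed.

(** The mean value theorem along [s *: b] turns the second difference of [f] into
a first difference of ['D_b f] between two points at distance of order [s] from
[p], to which the expansion of ['D_b f] at [p] applies. *)
Lemma cvg_second_difference f p a b c :
  (\forall x \near p, derivable f x b) ->
  has_gradient (fun x => 'D_b f x) p c ->
  (s ^- 2 * (f (p + s *: b + s *: a) - f (p + s *: b) - (f (p + s *: a) - f p)))
    @[s --> (0 : R)^'] --> dotv c a.
Proof.
move=> /nbhs_ballP[d1 /= d10 fd] gc; apply/cvgrPdist_le => /= e e0.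
(* the points k1, k2 below satisfy `|k1| + `|k2| <= `|s| * (`|a| + 2 * `|b|) *)
pose M := `|a| + 2 * `|b| + 1.
have M0 : 0 < M by rewrite ltr_wpDl// addr_ge0// mulr_ge0.
have /nbhs_ballP[d2 /= d20 gd] := gc _ (divr_gt0 e0 M0).
pose d := Num.min d1 d2; have d0 : 0 < d by rewrite lt_min d10.
near=> s.
have s0 : s != 0 by near: s; exact: nbhs_dnbhs_neq.
have sd : `|s| * M < d.
  by rewrite -ltr_pdivlMr//; near: s; apply: dnbhs0_lt; exact: divr_gt0.
have small k : `|k| <= `|s| * M -> derivable f (p + k) b /\
    `|'D_b f (p + k) - 'D_b f p - dotv c k| <= e / M * `|k|.
  move=> ks; have kd : `|k| < d := le_lt_trans ks sd.
  move: kd; rewrite lt_min => /andP[kd1 kd2]; split.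
    by apply: fd; rewrite -ball_normE /= opprD addNKr normrN.
  by apply: gd; rewrite -ball_normE /= sub0r normrN.
pose k2 (t : R) := t *: (s *: b); pose k1 t := k2 t + s *: a.
have k2_le t : 0 <= t <= 1 -> `|k2 t| <= `|s| * `|b|.
  move=> /andP[t0 t1]; rewrite !normrZ ger0_norm// -[leRHS]mul1r.
  by rewrite ler_wpM2r// mulr_ge0.
have k1_le t : 0 <= t <= 1 -> `|k1 t| <= `|s| * `|b| + `|s| * `|a|.
  by move=> t01; rewrite (le_trans (ler_normD _ _))// lerD ?k2_le// normrZ.
have k2_ok t : 0 <= t <= 1 -> `|k2 t| <= `|s| * M.
  move=> t01; rewrite (le_trans (k2_le _ t01))// ler_wpM2l// /M.
  by have := normr_ge0 a; have := normr_ge0 b; lra.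
have k1_ok t : 0 <= t <= 1 -> `|k1 t| <= `|s| * M.
  move=> t01; rewrite (le_trans (k1_le _ t01))// -mulrDr ler_wpM2l// /M.
  by have := normr_ge0 a; have := normr_ge0 b; lra.
have Gd t : 0 <= t <= 1 ->
    is_derive (p + k2 t) (s *: b) (fun q => f (q + s *: a) - f q)
      (s * 'D_b f (p + k1 t) - s * 'D_b f (p + k2 t)).
  move=> t01; apply: is_deriveB.
    apply: is_derive_translate; rewrite -addrA; apply: is_derive_scale.
    exact: (small _ (k1_ok _ t01)).1.
  by apply: is_derive_scale; exact: (small _ (k2_ok _ t01)).1.
have [t t01] := @segment_MVT R _ (fun q => f (q + s *: a) - f q) p (s *: b)
  (fun t t01 => let D := Gd t t01 in @ex_derive _ _ _ _ _ _ _ D).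
have [_ ->] := Gd t t01; rewrite -mulrBr => E.
rewrite (_ : _ - (f (p + s *: a) - f p) =
  s * ('D_b f (p + k1 t) - 'D_b f (p + k2 t))); last by rewrite -E; ring.
have [_ g1] := small _ (k1_ok _ t01).
have [_ g2] := small _ (k2_ok _ t01).
rewrite (_ : _ - _ = - s^-1 * (('D_b f (p + k1 t) - 'D_b f p - dotv c (k1 t)) -
    ('D_b f (p + k2 t) - 'D_b f p - dotv c (k2 t)))); last first.
  by rewrite /k1 dotvDr (dotvZr s c a); field.
rewrite normrM normrN normfV mulrC ler_pdivrMr ?normr_gt0//.
rewrite (le_trans (ler_normB _ _))// (le_trans (lerD g1 g2))// -mulrDr.
rewrite mulrAC ler_pdivrMr// -mulrA ler_pM2l//.
rewrite (le_trans (lerD (k1_le _ t01) (k2_le _ t01)))// -!mulrDr ler_wpM2l// /M.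
by lra.
Unshelve. all: by end_near. Qed.

(** Schwarz's theorem under pointwise differentiability of the first derivatives:
the second difference is symmetric in [a] and [b], and computing its limit in
the two orders gives the two sides. *)
Lemma mixed_derivatives f p a b ca cb :
  (\forall x \near p, derivable f x a) -> (\forall x \near p, derivable f x b) ->
  has_gradient (fun x => 'D_a f x) p ca -> has_gradient (fun x => 'D_b f x) p cb ->
  dotv cb a = dotv ca b.
Proof.
move=> fa fb ga gb; have Fa := cvg_second_difference (a := b) fa ga.
have Fb := cvg_second_difference (a := a) fb gb.
apply: (@cvg_unique _ (@Rhausdorff R) _ _ _ _ Fb).
rewrite (_ : (fun s : R => _) = (fun s : R => s ^- 2 *
  (f (p + s *: a + s *: b) - f (p + s *: a) - (f (p + s *: b) - f p)))) //.
by apply/funext => s; rewrite [p + _ + _]addrAC; congr (_ * _); ring.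
Qed.

Lemma near_translate p (P : set V3) :
  (\forall x \near p, P x) -> \forall k \near (0 : V3), P (p + k).
Proof.
move=> /nbhs_ballP[d /= d0 dP]; apply/nbhs_ballP; exists d => // k.
rewrite -ball_normE /= sub0r normrN => kd.
by apply: dP; rewrite -ball_normE /= opprD addNKr normrN.
Qed.

(** The product rule for a factor [f] that is merely continuous at [p]: as [psi]
vanishes there, the variation of [f] is multiplied by [psi (p + k)], which is
of order [k]. *)
Lemma has_gradientM0 f psi p c : {for p, continuous f} ->
  has_gradient psi p c -> psi p = 0 -> has_gradient (f \* psi) p (f p *: c).
Proof.
move=> fC psic psi0 e e0.
pose C := \sum_i `|c 0 i|; have C0 : 0 <= C by rewrite sumr_ge0.
have C2 : 0 < C + 1 by rewrite ltr_wpDl.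
have F1 : 0 < `|f p| + 1 by rewrite ltr_wpDl.
have e1 : 0 < e / 2 / (`|f p| + 1) by rewrite !divr_gt0.
have e2 : 0 < e / 2 / (C + 1) by rewrite !divr_gt0.
have fk : \forall k \near (0 : V3), `|f p - f (p + k)| <= e / 2 / (C + 1).
  by apply: (@near_translate p (fun x => `|f p - f x| <= _));
     move/cvgrPdist_le : fC; apply.
near=> k.
have p1 : `|psi (p + k) - psi p - dotv c k| <= e / 2 / (`|f p| + 1) * `|k|.
  by near: k; exact: psic.
have p2 : `|psi (p + k) - psi p - dotv c k| <= 1 * `|k|.
  by near: k; exact: psic.
have p3 : `|f p - f (p + k)| <= e / 2 / (C + 1) by near: k.
rewrite psi0 !subr0 in p1 p2.
have psik : `|psi (p + k)| <= (C + 1) * `|k|.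
  rewrite -(subrK (dotv c k) (psi _)) (le_trans (ler_normD _ _))//.
  by rewrite mulrDl addrC lerD// dotv_bound.
rewrite /= psi0 mulr0 subr0 dotvZl.
rewrite (_ : _ - _ = f p * (psi (p + k) - dotv c k) -
   (f p - f (p + k)) * psi (p + k)); last by ring.
rewrite (le_trans (ler_normB _ _))//.
rewrite [leRHS](_ : _ = e / 2 * `|k| + e / 2 * `|k|); last by rewrite -mulrDl -splitr.
rewrite !normrM lerD//.
  apply: (@le_trans _ _ ((`|f p| + 1) * (e / 2 / (`|f p| + 1) * `|k|))).
    by rewrite ler_pM// lerDl.
  by rewrite mulrA [_ * (_ / _)]mulrC divfK// gt_eqF.
apply: (le_trans (ler_pM _ _ p3 psik)) => //.
by rewrite mulrA divfK// gt_eqF.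
Unshelve. all: by end_near. Qed.

End Gradient.

(** * Gradients parallel to a field of nonzero helicity *)

Section OrthogonalGradient.
Context {R : realType}.
Local Notation V3 := 'rV[R]_3.
Implicit Types (D : set V3) (f g u lam : V3 -> R) (w : V3 -> V3).
Implicit Types (p a b c : V3).

Lemma sum_ord3 (M : zmodType) (F : 'I_3 -> M) : \sum_i F i = F 0 + F 1 + F 2.
Proof.
rewrite !big_ord_recl big_ord0 addr0 addrA.
by congr (_ + F _ + F _); exact/val_inj.
Qed.

Lemma row3P a b : a 0 0 = b 0 0 -> a 0 1 = b 0 1 -> a 0 2 = b 0 2 -> a = b.
Proof.
move=> e0 e1 e2; apply/rowP => -[[|[|[|//]]] jP].
- by have -> : Ordinal jP = 0 by exact/val_inj.
- by have -> : Ordinal jP = 1 by exact/val_inj.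
- by have -> : Ordinal jP = 2 by exact/val_inj.
Qed.

Lemma row3E (x y z : R) :
  (row3 x y z 0 0 = x) * (row3 x y z 0 1 = y) * (row3 x y z 0 2 = z).
Proof. by rewrite /row3 !mxE. Qed.

Lemma gradE f x i : grad f x 0 i = partial i f x.
Proof. by rewrite mxE. Qed.

Lemma dotv_suml (s : 'I_3 -> R) (c : 'I_3 -> V3) k :
  dotv (\sum_i s i *: c i) k = \sum_i s i * dotv (c i) k.
Proof.
rewrite /dotv; under [LHS]eq_bigr do rewrite summxE mulr_suml.
rewrite exchange_big /=; apply: eq_bigr => i _; rewrite mulr_sumr.
by apply: eq_bigr => j _; rewrite !mxE mulrA.
Qed.

Lemma crossv_crossv a b : crossv a (crossv b a) = dotv a a *: b - dotv a b *: a.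
Proof. by apply: row3P; rewrite !dotvE /crossv !row3E !mxE; ring. Qed.

Definition C1_on D f := [/\ forall x, D x -> {for x, continuous f},
  forall i x, D x -> derivable f x (delta_mx 0 i) &
  forall i x, D x -> {for x, continuous (partial i f)}].

Lemma continuous_within_open D f x : open D ->
  {within closure D, continuous f} -> D x -> {for x, continuous f}.
Proof.
move=> Dopen fC Dx; have : {within D, continuous f}.
  by apply: continuous_subspaceW fC; exact: subset_closure.
by rewrite continuous_open_subspace// => /(_ x); rewrite inE; apply.
Qed.

Lemma C1_on_has_gradient D f p : open D -> C1_on D f -> D p ->
  has_gradient f p (grad f p).
Proof.
move=> Dopen [_ fd fC] Dp; apply: C1_has_gradient => i; last exact: fC.
by apply: filterS (open_nbhs_nbhs (conj Dopen Dp)) => x; exact: fd.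
Qed.

Lemma Ck_closure_C1_on D f : open D -> Ck_closure 1 D f -> C1_on D f.
Proof.
move=> Dopen [fC fD]; split=> [x|i x Dx|i x Dx].
- exact: continuous_within_open.
- by have [/(_ isT) fd _] := fD [::]; exact: fd.
- have [_ /(_ isT)[g gC gE]] := fD [:: i].
have gx : {for x, continuous g} := continuous_within_open Dopen gC Dx.
suff : partial i f y @[y --> x] --> g x by rewrite (gE x Dx).
apply: cvg_trans gx; apply: (@near_eq_cvg _ _ (nbhs x)).
near=> y; apply: gE; near: y; exact: open_nbhs_nbhs.
Unshelve. all: by end_near.
Qed.

Lemma has_gradient_near f g p c : (\forall x \near p, f x = g x) ->
  has_gradient f p c -> has_gradient g p c.
Proof.
move=> fg fc e e0; have fgp : f p = g p := nbhs_singleton fg.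
near=> k; rewrite -fgp.
have <- : f (p + k) = g (p + k) by near: k;
  exact: (near_translate (P := fun x => f x = g x)).
by near: k; exact: fc.
Unshelve. all: by end_near. Qed.

Lemma has_gradient_dotv w p a (c : 'I_3 -> V3) :
  (forall i, has_gradient (component i w) p (c i)) ->
  has_gradient (fun x => dotv (w x) a) p (\sum_i a 0 i *: c i).
Proof.
move=> wc e e0; pose C := \sum_i `|a 0 i|.
have C0 : 0 < C + 1 by rewrite ltr_wpDl// sumr_ge0.
have : \forall k \near (0 : V3), forall i : 'I_3,
    `|w (p + k) 0 i - w p 0 i - dotv (c i) k| <= e / (C + 1) * `|k|.
  apply: (@filter_forall _ _ (fun i k => _) _ (@nbhs_filter _ (0 : V3))) => i.
  by apply: wc; exact: divr_gt0.
apply: filterS => k wk.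
rewrite (_ : _ - _ =
  \sum_i (a 0 i * (w (p + k) 0 i - w p 0 i - dotv (c i) k))); last first.
  rewrite [RHS](eq_bigr (fun i =>
     w (p + k) 0 i * a 0 i - w p 0 i * a 0 i - a 0 i * dotv (c i) k)).
    by rewrite dotv_suml !big_split /= !sumrN.
  by move=> i _; ring.
rewrite (le_trans (ler_norm_sum _ _ _))//.
apply: (@le_trans _ _ (\sum_i `|a 0 i| * (e / (C + 1) * `|k|))).
  by apply: ler_sum => i _; rewrite normrM ler_wpM2l.
rewrite -mulr_suml -/C mulrA ler_wpM2r// mulrA ler_pdivrMr// mulrC ler_wpM2l//.
  exact: ltW.
by rewrite lerDl.
Qed.

(** Substitute for the curl of [lam w = grad u] when [lam] is merely continuous:
orthogonality of [a] and [b] to [w p] makes ['D_a u] and ['D_b u] differentiable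
at [p], and their mixed derivatives agree. *)
Lemma grad_parallel_mixed D u lam w p a b : open D -> D p -> C1_on D u ->
  (forall i, C1_on D (component i w)) -> {for p, continuous lam} ->
  (forall x, D x -> grad u x = lam x *: w x) ->
  dotv (w p) a = 0 -> dotv (w p) b = 0 ->
  lam p * dotv (curl w p) (crossv a b) = 0.
Proof.
move=> Dopen Dp uC wC lamC uw wa wb.
have Dnear : \forall x \near p, D x := open_nbhs_nbhs (conj Dopen Dp).
pose c (d : V3) := \sum_i d 0 i *: grad (component i w) p.
have ud d x : D x -> is_derive x d u (lam x * dotv (w x) d).
  move=> Dx; rewrite -dotvZl -uw//; apply: has_gradient_derive.
  exact: C1_on_has_gradient uC Dx.
have uderiv d : \forall x \near p, derivable u x d.
  by apply: filterS Dnear => x /(ud d) [].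
have ugrad d : dotv (w p) d = 0 ->
    has_gradient (fun x => 'D_d u x) p (lam p *: c d).
  move=> wd; apply: (@has_gradient_near (lam \* (fun x => dotv (w x) d))).
    by apply: filterS Dnear => x /(ud d) [].
  apply: has_gradientM0 => //; apply: has_gradient_dotv => i.
  exact: C1_on_has_gradient (wC i) Dp.
have := mixed_derivatives (uderiv a) (uderiv b) (ugrad a wa) (ugrad b wb).
rewrite !dotvZl => /eqP; rewrite -subr_eq0 -mulrBr => /eqP <-; congr (_ * _).
rewrite /c !dotv_suml !sum_ord3.
rewrite !dotvE.
rewrite /curl /crossv.
rewrite !row3E.
rewrite !gradE.
(* an identity between the entries of a, b and of the Jacobian matrix J of w,
   as the curl is the antisymmetric part of J *)
move: (a 0 0) (a 0 1) (a 0 2) => a0 a1 a2.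
move: (b 0 0) (b 0 1) (b 0 2) => b0 b1 b2.
move: (partial 0 (component 0 w) p) (partial 1 (component 0 w) p)
  (partial 2 (component 0 w) p) => J00 J01 J02.
move: (partial 0 (component 1 w) p) (partial 1 (component 1 w) p)
  (partial 2 (component 1 w) p) => J10 J11 J12.
move: (partial 0 (component 2 w) p) (partial 1 (component 2 w) p)
  (partial 2 (component 2 w) p) => J20 J21 J22.
ring.
Qed.

(** The vectors [crossv a (w p)] are orthogonal to [w p]; taking two basis vectors
for [a], the cross product of the two results is a coordinate of [w p] times
[w p], and some coordinate is nonzero. *)
Lemma grad_parallel_eq0 D u lam w p : open D -> D p -> C1_on D u ->
  (forall i, C1_on D (component i w)) -> {for p, continuous lam} ->
  (forall x, D x -> grad u x = lam x *: w x) ->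
  helicity w p != 0 -> w p != 0 -> lam p = 0.
Proof.
move=> Dopen Dp uC wC lamC uw hp wp.
have ortho a : dotv (w p) (crossv a (w p)) = 0.
  by rewrite dotvE !mxE /=; ring.
have comp (k : 'I_3) a b : crossv (crossv a (w p)) (crossv b (w p)) = w p 0 k *: w p ->
    w p 0 k * lam p = 0.
  move=> E; have := grad_parallel_mixed Dopen Dp uC wC lamC uw (ortho a) (ortho b).
  rewrite E dotvZr dotvC -/(helicity w p) mulrCA mulrA => /eqP.
  by rewrite mulf_eq0 (negPf hp) orbF => /eqP.
apply/eqP/negPn/negP => lp; case/negP: wp; apply/eqP/rowP => k.
rewrite [RHS]mxE; apply/eqP.
suff : w p 0 k * lam p = 0 by move=> /eqP; rewrite mulf_eq0 (negPf lp) orbF.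
have : [\/ k = 0, k = 1 | k = 2].
  case: k => [[|[|[|//]]] kP].
  - by apply: Or31; exact/val_inj.
  - by apply: Or32; exact/val_inj.
  - by apply: Or33; exact/val_inj.
case=> ->.
- apply: (comp 0 (row3 0 1 0) (row3 0 0 1)).
  by apply: row3P; rewrite !mxE /= ?mxE /=; ring.
- apply: (comp 1 (row3 0 0 1) (row3 1 0 0)).
  by apply: row3P; rewrite !mxE /= ?mxE /=; ring.
- apply: (comp 2 (row3 1 0 0) (row3 0 1 0)).
  by apply: row3P; rewrite !mxE /= ?mxE /=; ring.
Qed.

Lemma dotv_gt0 a : a != 0 -> 0 < dotv a a.
Proof.
move=> a0; rewrite lt_neqAle eq_sym andbC /dotv sumr_ge0 /=; last first.
  by move=> i _; rewrite -expr2 sqr_ge0.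
apply: contra a0; rewrite psumr_eq0 => [/allP a0|i _]; last by rewrite -expr2 sqr_ge0.
apply/eqP/rowP => i; rewrite mxE.
by have := a0 i; rewrite mem_index_enum mulf_eq0 orbb => /(_ isT)/eqP.
Qed.

Lemma dotv_ge0 a : 0 <= dotv a a.
Proof. by rewrite /dotv sumr_ge0// => i _; rewrite -expr2 sqr_ge0. Qed.

Lemma dotv_eq0 a : dotv a a = 0 -> a = 0.
Proof. by move=> a0; apply/eqP/negPn/negP => /dotv_gt0; rewrite a0 ltxx. Qed.

(** * The orthogonal gradient *)

Definition parallel_coef w f x : R := dotv (w x) (grad f x) / dotv (w x) (w x).

Lemma grad_perpE w f x : w x != 0 ->
  grad_perp w f x = grad f x - parallel_coef w f x *: w x.
Proof.
move=> /dotv_gt0/lt0r_neq0 w0; rewrite /grad_perp crossv_crossv scalerBr !scalerA.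
by rewrite mulVf// scale1r mulrC.
Qed.

Lemma grad_perp_dotE w f g x : w x != 0 ->
  dotv (grad_perp w f x) (grad_perp w g x) = dotv (grad f x) (grad g x) -
    dotv (w x) (grad f x) * dotv (w x) (grad g x) / dotv (w x) (w x).
Proof.
move=> wx; have w0 := lt0r_neq0 (dotv_gt0 wx).
rewrite !grad_perpE// /parallel_coef dotvBr dotvZr ![dotv (_ - _) _]dotvC.
rewrite !(dotvBr, dotvZr) !(dotvC (grad _ _) (w x)) (dotvC (grad g x)).
by field.
Qed.

Lemma continuous_dotv (v1 v2 : V3 -> V3) x :
  (forall i, {for x, continuous (component i v1)}) ->
  (forall i, {for x, continuous (component i v2)}) ->
  {for x, continuous (fun y => dotv (v1 y) (v2 y))}.
Proof.
move=> c1 c2; have -> : (fun y => dotv (v1 y) (v2 y)) =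
    (component 0 v1 \* component 0 v2) + (component 1 v1 \* component 1 v2) +
    (component 2 v1 \* component 2 v2).
  by apply/funext => y; rewrite dotvE.
by do 2?[apply: continuousD]; apply: continuousM; do [exact: c1|exact: c2].
Qed.

Lemma continuous_component_grad D f i x : C1_on D f -> D x ->
  {for x, continuous (component i (grad f))}.
Proof.
move=> [_ _ fC] Dx; rewrite (_ : component i (grad f) = partial i f); first exact: fC.
by apply/funext => y; rewrite /component mxE.
Qed.

Lemma continuous_parallel_coef D w f x : (forall i, C1_on D (component i w)) ->
  C1_on D f -> D x -> w x != 0 -> {for x, continuous (parallel_coef w f)}.
Proof.
move=> wC fC Dx wx; have wc i : {for x, continuous (component i w)}.
  by have [+ _ _] := wC i; apply.
apply: (@continuousM _ _ (fun y => dotv (w y) (grad f y))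
  (fun y => (dotv (w y) (w y))^-1)).
  apply: continuous_dotv => // i; exact: continuous_component_grad fC Dx.
apply: continuousV; first exact/lt0r_neq0/dotv_gt0.
exact: (continuous_dotv wc wc).
Qed.

Lemma continuous_grad_perp_dot D w f g x : (forall i, C1_on D (component i w)) ->
  (forall y, D y -> w y != 0) -> open D -> C1_on D f -> C1_on D g -> D x ->
  {for x, continuous (fun y => dotv (grad_perp w f y) (grad_perp w g y))}.
Proof.
move=> wC w0 Dopen fC gC Dx.
have wc i : {for x, continuous (component i w)} by have [+ _ _] := wC i; apply.
have fc (i : 'I_3) : {for x, continuous (component i (grad f))}.
  exact: continuous_component_grad fC Dx.
have gc (i : 'I_3) : {for x, continuous (component i (grad g))}.
  exact: continuous_component_grad gC Dx.
pose F := (fun y => dotv (grad f y) (grad g y)) -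
  (fun y => dotv (w y) (grad f y)) \* (fun y => dotv (w y) (grad g y)) \*
  (fun y => (dotv (w y) (w y))^-1).
have Fx : dotv (grad_perp w f x) (grad_perp w g x) = F x.
  by rewrite grad_perp_dotE// w0.
suff : (fun y => dotv (grad_perp w f y) (grad_perp w g y)) @ x --> F x by rewrite -Fx.
have : {for x, continuous F}.
  apply: continuousB; first exact: (continuous_dotv fc gc).
  apply: continuousM; first by apply: continuousM;
    [exact: (continuous_dotv wc fc)|exact: (continuous_dotv wc gc)].
  apply: continuousV; first exact/lt0r_neq0/dotv_gt0/w0.
  exact: (continuous_dotv wc wc).
apply: cvg_trans; apply: (@near_eq_cvg _ _ (nbhs x)).
near=> y; rewrite grad_perp_dotE// w0//; near: y; exact: open_nbhs_nbhs.
Unshelve. all: by end_near. Qed.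

Lemma grad_perp_eq0 D u w : open D -> C1_on D u ->
  (forall i, C1_on D (component i w)) ->
  (forall x, D x -> w x != 0) -> (forall x, D x -> helicity w x != 0) ->
  (forall x, D x -> grad_perp w u x = 0) -> forall x, D x -> grad u x = 0.
Proof.
move=> Dopen uC wC w0 h0 gp0 x Dx.
have uw y : D y -> grad u y = parallel_coef w u y *: w y.
  by move=> Dy; have := gp0 y Dy; rewrite grad_perpE ?w0// => /subr0_eq.
have lamC := continuous_parallel_coef wC uC Dx (w0 x Dx).
by rewrite uw// (grad_parallel_eq0 Dopen Dx uC wC lamC uw (h0 x Dx) (w0 x Dx)) scale0r.
Qed.

(** From a point [p] of [D] follow the ray in the first coordinate direction up to
its exit time [T], finite as [D] is bounded.  The exit point lies in the closure
of [D] but not in [D], so [u] vanishes there, while [u] equals [u p] all along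
the half-open segment before it. *)
Lemma const_gradient_eq0 D u : open D -> bounded_set D ->
  {within closure D, continuous u} -> (forall x, ~ D x -> u x = 0) ->
  C1_on D u -> (forall x, D x -> grad u x = 0) -> u = cst 0.
Proof.
move=> Dopen Dbnd uC u0 [_ ud _] du; apply/funext => p /=.
have [Dp|/u0//] := pselect (D p).
pose e : V3 := delta_mx 0 0.
pose S : set R := [set t | 0 <= t /\ ~ D (p + t *: e)].
have Sinf : has_inf S.
  split; last by exists 0 => t [].
  have [M [_ DM]] := Dbnd.
  pose t := `|p 0 0| + `|M| + 2.
  exists t; split; first by rewrite !addr_ge0.
  move=> /(DM (`|M| + 1) ltac:(by rewrite ltr_pwDr// ler_norm)) /= le_pt.
  have := le_trans (ler_coord_norm (p + t *: e) 0) le_pt.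
  rewrite !mxE eqxx mulr1 /t => /(le_trans (ler_norm _)).
  by have := ler_norm (- p 0 0); rewrite normrN; lra.
pose T := inf S.
have T0 : 0 <= T by apply: lb_le_inf; [case: Sinf|move=> t []].
have ray_in t : 0 <= t < T -> D (p + t *: e).
  move=> /andP[t0 tT]; apply: contrapT => Dt.
  by have := ge_inf Sinf.2 (conj t0 Dt); rewrite leNgt tT.
have near_ray (P : set V3) : nbhs (p + T *: e) P ->
    exists2 d, 0 < d & forall t, `|T - t| < d -> P (p + t *: e).
  move=> /nbhs_ballP[d /= d0 dP]; exists d => // t td; apply: dP.
  rewrite -ball_normE /= opprD addrACA subrr add0r -scalerBl normrZ.
  rewrite (le_lt_trans _ td)// ler_piMr//; apply: row_norm_le => // i.
  by rewrite mxE eqxx /=; case: eqP => _; rewrite ?normr1 ?normr0.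
have DT : ~ D (p + T *: e).
  move=> DT; have [d d0 dD] := near_ray _ (open_nbhs_nbhs (conj Dopen DT)).
  have [t St tT] := inf_adherent d0 Sinf.
  apply: St.2; apply: dD; rewrite distrC ger0_norm ?ltrBlDl//.
  by rewrite subr_ge0; exact: (ge_inf Sinf.2 St).
have Tp : 0 < T.
  rewrite lt_neqAle T0 andbT; apply/eqP => T00.
  by apply: DT; rewrite -T00 scale0r addr0.
have u_ray t : 0 <= t < T -> u (p + t *: e) = u p.
  move=> /andP[t0 tT].
  have uray s : 0 <= s <= 1 -> is_derive (p + s *: (t *: e)) (t *: e) u 0.
    move=> /andP[s0 s1]; have Ds : D (p + s *: (t *: e)).
      rewrite scalerA; apply: ray_in; rewrite mulr_ge0//=.
      by rewrite (le_lt_trans _ tT)// ler_piMl.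
    apply: (is_derive_eq (is_derive_scale t (ud 0 _ Ds))).
    by have /rowP/(_ 0) := du _ Ds; rewrite !mxE /partial -/e => ->; rewrite mulr0.
  have [s s01] := @segment_MVT R _ u p (t *: e)
    (fun s s01 => @ex_derive _ _ _ _ _ _ _ (uray s s01)).
  by have [_ ->] := uray s s01 => /eqP; rewrite subr_eq0 => /eqP.
have approach (P : set V3) : nbhs (p + T *: e) P -> exists2 t, 0 <= t < T & P (p + t *: e).
  move=> /near_ray[d d0 dP]; have m0 : 0 < Num.min T d by rewrite lt_min Tp.
  have [mT md] : Num.min T d <= T /\ Num.min T d <= d by rewrite !ge_min !lexx orbT.
  exists (T - Num.min T d / 2); first by apply/andP; split; lra.
  by apply: dP; rewrite opprB addrCA subrr addr0 ger0_norm; lra.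
have clT : closure D (p + T *: e).
  by move=> B /approach[t /ray_in Dt Bt]; exists (p + t *: e).
apply/eqP/negPn/negP => up0.
move/subspace_continuousP : uC => /(_ _ clT)/cvgrPdist_lt/(_ `|u p|).
rewrite normr_gt0 => /(_ up0)/approach[t tT /(_ (subset_closure (ray_in t tT)))].
by rewrite /from_subspace (u0 _ DT) (u_ray _ tT) sub0r normrN ltxx.
Qed.

End OrthogonalGradient.

(** * Volume integrals over bounded open sets *)

Section VolumeIntegral.
Context {R : realType}.
Local Notation V3 := 'rV[R]_3.
Local Notation leb := (@lebesgue_measure R).
Local Notation mu3 := ((leb \x leb) \x leb)%E.
Implicit Types (D : set V3) (f g : V3 -> R).

Local Notation mR := (measurableTypeR R).

Definition row3_of (p : R * R * R) : V3 := row3 p.1.1 p.1.2 p.2.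

Local Notation region D := [set p : mR * mR * mR | D (row3 p.1.1 p.1.2 p.2)].

Definition cube (a b c r : R) : set (mR * mR * mR) :=
  (`]a - r, a + r[ `*` `]b - r, b + r[) `*` `]c - r, c + r[.

Lemma cubeP a b c r (p : R * R * R) : cube a b c r p <->
  [/\ `|a - p.1.1| < r, `|b - p.1.2| < r & `|c - p.2| < r].
Proof.
rewrite /cube /= !in_itv /= -!ltr_distl !(distrC a) !(distrC b) !(distrC c).
by split=> [[[]]|[]].
Qed.

Lemma measurable_cube a b c r : measurable (cube a b c r).
Proof. by apply: measurableX; first apply: measurableX; exact: measurable_itv. Qed.

Lemma mu_cube a b c r : 0 < r -> mu3 (cube a b c r) = ((r *+ 2) ^+ 3)%:E.
Proof.
move=> r0; have itvE (x : R) : leb `]x - r, x + r[ = (r *+ 2)%:E.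
  rewrite lebesgue_measure_itv /= lte_fin ltrBlDr -addrA ltrDl addr_gt0//.
  by rewrite EFinN -EFinB opprB addrC addrA subrK mulr2n.
rewrite /cube product_measure1E; [|by apply: measurableX|by []].
rewrite [X in (X * _)%E]product_measure1E// [X in (_ * X)%E](itvE c).
rewrite [X in (X * _ * _)%E](itvE a) [X in (_ * X * _)%E](itvE b) -!EFinM.
by congr (_%:E); rewrite !exprSr expr0 mul1r.
Qed.

Lemma cube_ball D a b c : open D -> D (row3 a b c) ->
  exists2 r, 0 < r & cube a b c r `<=` region D.
Proof.
move=> Dopen Dx; have /nbhs_ballP[d /= d0 dD] := open_nbhs_nbhs (conj Dopen Dx).
exists (d / 2); first by rewrite divr_gt0.
move=> [[x y] z] /cubeP[/= ax bx cx]; apply: dD; rewrite -ball_normE /=.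
apply: (@le_lt_trans _ _ (d / 2)); last by rewrite ltr_pdivrMr// ltr_pMr// ltr1n.
apply: row_norm_le => [|i]; first by rewrite ltW// divr_gt0.
rewrite !mxE; case: i => [[|[|[|//]]] iP] /=; exact: ltW.
Qed.

(** The product sigma-algebra is generated by boxes: an open set is the union of
the countably many cubes with rational centres and radii [1 / n] that it
contains. *)
Lemma measurable_region D : open D -> measurable (region D).
Proof.
move=> Dopen.
pose C (i : rat * rat * rat * nat) : set (mR * mR * mR) :=
  cube (ratr i.1.1.1) (ratr i.1.1.2) (ratr i.1.2) i.2.+1%:R^-1.
pose C' i := if `[< C i `<=` region D >] then C i else set0.
have -> : region D = \bigcup_i C' i.
  apply/seteqP; split=> [[[x y] z] /= Dp|p [i _]]; last first.
    by rewrite /C'; case: asboolP => // CD /CD.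
  have [r r0 rD] := cube_ball Dopen Dp.
  (* radius below r / 2: a cube that contains the point stays within r of it *)
  have [n nr] : exists n : nat, n.+1%:R^-1 < r / 2 :> R.
    have := near_infty_natSinv_lt (PosNum (divr_gt0 r0 (ltr0n R 2))).
    by move=> [n _ /(_ n (leqnn n)) nr]; exists n.
  have near_rat (t : R) : exists q : rat, `|ratr q - t| < n.+1%:R^-1.
    have /rat_in_itvoo[q] : t - n.+1%:R^-1 < t + n.+1%:R^-1.
      by rewrite ltrBlDr -addrA ltrDl addr_gt0// invr_gt0.
    by rewrite in_itv /= -ltr_distl => tq; exists q.
  have [q1 xq] := near_rat x; have [q2 yq] := near_rat y; have [q3 zq] := near_rat z.
  exists (q1, q2, q3, n) => //; rewrite /C' ifT; first exact/cubeP.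
  apply/asboolP => -[[x' y'] z'] /cubeP[/= x'q y'q z'q]; apply: (rD (x', y', z')); apply/cubeP.
  have tri (q t t' : R) : `|q - t| < n.+1%:R^-1 -> `|q - t'| < n.+1%:R^-1 ->
      `|t - t'| < r.
    move=> qt qt'; rewrite -(subrK q t) -addrA (le_lt_trans (ler_normD _ _))//.
    by rewrite [r]splitr ltrD// ?(distrC t) (lt_trans _ nr).
  by split; [exact: tri xq x'q|exact: tri yq y'q|exact: tri zq z'q].
apply: countable_bigcupT_measurable => [|i]; first exact: countableP.
by rewrite /C'; case: ifP => _ //; exact: measurable_cube.
Qed.

Lemma measurable_fun_region D f : open D ->
  (forall x, D x -> {for x, continuous f}) ->
  measurable_fun (region D) (fun p => f (row3_of p)).
Proof.
move=> Dopen fC mD; apply: (measurability _ (measurable_realfun.RGenOInfty.measurableE R)) => //.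
move=> _ [_ [a ->] <-].
have -> : region D `&` (fun p => f (row3_of p)) @^-1` `]a, +oo[ =
    region [set x | D x /\ a < f x].
  by apply/seteqP; split => p /=; rewrite in_itv/= andbT.
apply: measurable_region; rewrite openE => x [Dx ax].
apply: filterI; first exact: open_nbhs_nbhs.
exact: (cvgr_gt _ (fC x Dx) _ ax).
Qed.

Lemma mu_region_fin D : open D -> bounded_set D -> (mu3 (region D) < +oo)%E.
Proof.
move=> Dopen [M [_ DM]].
have M0 : 0 < `|M| + 2 by rewrite ltr_wpDl.
apply: (@le_lt_trans _ _ (mu3 (cube 0 0 0 (`|M| + 2)))); last first.
  by rewrite mu_cube// ltry.
apply: le_measure; rewrite ?inE; [exact: measurable_region|exact: measurable_cube|].
move=> [[x y] z] /= /(DM (`|M| + 1) ltac:(by rewrite ltr_pwDr// ler_norm)) /= le_x.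
have bnd (i : 'I_3) : `|row3 x y z 0 i| < `|M| + 2.
  by rewrite (le_lt_trans (ler_coord_norm _ i))// (le_lt_trans le_x)// ltrD2l ltr1n.
apply/cubeP; rewrite !sub0r !normrN /=.
by split; [have := bnd 0|have := bnd 1|have := bnd 2]; rewrite row3E.
Qed.

Lemma integrable_region D f (M : R) : open D -> bounded_set D ->
  (forall x, D x -> {for x, continuous f}) -> (forall x, D x -> `|f x| <= M) ->
  mu3.-integrable (region D) (EFin \o (fun p => f (row3_of p))).
Proof.
move=> Dopen Dbnd fC fM; apply: measurable_bounded_integrable.
- exact: measurable_region.
- exact: mu_region_fin.
- exact: measurable_fun_region.
exists M; split; first exact: num_real.
by move=> N MN p Dp; rewrite /= (le_trans (fM _ Dp))// ltW.
Qed.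

(** The bounds ensure integrability: a divergent integral has the default real
value 0, which would break additivity. *)
Lemma vol_int_linear D f g (a M N : R) : open D -> bounded_set D ->
  (forall x, D x -> {for x, continuous f}) -> (forall x, D x -> `|f x| <= M) ->
  (forall x, D x -> {for x, continuous g}) -> (forall x, D x -> `|g x| <= N) ->
  vol_int D (fun x => a * f x + g x) = a * vol_int D f + vol_int D g.
Proof.
move=> Dopen Dbnd fC fM gC gN; have mD := measurable_region Dopen.
have fI := integrable_region Dopen Dbnd fC fM.
have gI := integrable_region Dopen Dbnd gC gN.
have afI := integrableZl mD a fI.
by rewrite /vol_int RintegralD// RintegralZl.
Qed.

Lemma eq_vol_int D f g : (forall x, D x -> f x = g x) -> vol_int D f = vol_int D g.
Proof. by move=> fg; apply: eq_Rintegral => p; rewrite inE => /fg. Qed.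

Lemma vol_int_ge0 D f : (forall x, D x -> 0 <= f x) -> 0 <= vol_int D f.
Proof. by move=> f0; apply: Rintegral_ge0 => p /f0. Qed.

(** If [f x > 0] then [f] exceeds [f x / 2] on a small cube, which has positive
volume. *)
Lemma vol_int_eq0 D f (M : R) : open D -> bounded_set D ->
  (forall x, D x -> {for x, continuous f}) -> (forall x, D x -> `|f x| <= M) ->
  (forall x, D x -> 0 <= f x) -> vol_int D f = 0 -> forall x, D x -> f x = 0.
Proof.
move=> Dopen Dbnd fC fM f0 If x Dx; apply/eqP/negPn/negP => fx0.
have fx : 0 < f x by rewrite lt_neqAle eq_sym fx0 f0.
pose D' := [set y | D y /\ f x / 2 < f y].
have D'open : open D'.
  rewrite openE => y [Dy fy]; apply: filterI; first exact: open_nbhs_nbhs.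
  exact: (cvgr_gt _ (fC y Dy) _ fy).
have D'x : D' (row3 (x 0 0) (x 0 1) (x 0 2)).
  have -> : row3 (x 0 0) (x 0 1) (x 0 2) = x by apply: row3P; rewrite row3E.
  by split => //; rewrite ltr_pdivrMr// ltr_pMr// ltr1n.
have [r r0 rD'] := cube_ball D'open D'x.
set Q := cube _ _ _ r in rD'.
have mQ : measurable Q by exact: measurable_cube.
have QD : Q `<=` region D by move=> p /rD' [].
have fI := integrable_region Dopen Dbnd fC fM.
have mD := measurable_region Dopen.
have fQ : mu3.-integrable Q (EFin \o (fun p => f (row3_of p))).
  exact: integrableS fI.
have muQ : mu3 Q = ((r *+ 2) ^+ 3)%:E by exact: mu_cube.
have cQ : mu3.-integrable Q (EFin \o cst (f x / 2)).
  apply: measurable_bounded_integrable => //; first by rewrite [X in (X < _)%E]muQ ltry.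
  exists (f x / 2); split; first exact: num_real.
  by move=> N MN p _; rewrite /= ger0_norm ?ltW// divr_gt0.
have : \int[mu3]_(p in Q) (f x / 2) <= vol_int D f.
  apply: (@le_trans _ _ (\int[mu3]_(p in Q) f (row3_of p))).
    by apply: le_Rintegral => // p /rD' [_ /ltW].
  rewrite /vol_int /Rintegral fine_le//; [exact: integrable_fin_num fQ|exact: integrable_fin_num fI|].
  apply: ge0_subset_integral => //; first by case/integrableP: fI.
  by move=> p Dp; rewrite lee_fin f0.
rewrite If Rintegral_cst// [X in fine X]muQ /=; apply/negP; rewrite -ltNge.
by rewrite mulr_gt0// ?divr_gt0// exprn_gt0// mulr2n addr_gt0.
Qed.

End VolumeIntegral.

(** * The inner product of orthogonal gradients *)

Section BoundedGradient.
Context {R : realType}.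
Local Notation V3 := 'rV[R]_3.
Implicit Types (D : set V3) (f g : V3 -> R) (w : V3 -> V3) (a b : V3).

Lemma dotv_young a b : `|dotv a b| <= (dotv a a + dotv b b) / 2.
Proof.
rewrite /dotv -big_split /= mulr_suml (le_trans (ler_norm_sum _ _ _))//.
apply: ler_sum => i _; rewrite ler_pdivlMr// -!expr2 -subr_ge0.
rewrite -(real_normK (num_real (a 0 i))) -(real_normK (num_real (b 0 i))) normrM.
by rewrite [leRHS](_ : _ = (`|a 0 i| - `|b 0 i|) ^+ 2) ?sqr_ge0//; ring.
Qed.

Lemma grad_perp_le w f x : w x != 0 ->
  dotv (grad_perp w f x) (grad_perp w f x) <= dotv (grad f x) (grad f x).
Proof.
move=> wx; rewrite grad_perp_dotE// gerBl divr_ge0 ?dotv_ge0//.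
by rewrite -expr2 sqr_ge0.
Qed.

Lemma compact_closure_bounded D : bounded_set D -> compact (closure D).
Proof.
move=> [M [_ DM]]; apply: bounded_closed_compact; last exact: closed_closure.
exists (`|M| + 2); split=> [|N MN x clx]; first exact: num_real.
have [y [Dy]] := clx _ (nbhsx_ballx x 1 ltr01).
rewrite -ball_normE /= => xy.
have yM := DM (`|M| + 1) ltac:(by rewrite ltr_pwDr// ler_norm) y Dy.
rewrite -(subrK y x) (le_trans (ler_normD _ _))// (le_trans _ (ltW MN))//.
by rewrite (le_trans (lerD (ltW xy) yM))//; lra.
Qed.

(** The partial derivatives extend continuously to the closure of [D], which is
compact. *)
Lemma Ck_closure_gradient_bounded D f : bounded_set D -> Ck_closure 1 D f ->
  exists M, forall x, D x -> dotv (grad f x) (grad f x) <= M.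
Proof.
move=> /compact_closure_bounded Dc [_ fD].
have /choice[M fM] : forall i, exists M, forall x, D x -> `|partial i f x| <= M.
  move=> i; have [_ /(_ isT)[g gC gE]] := fD [:: i].
  have /compact_bounded[M [_ gM]] := continuous_compact gC Dc.
  exists (M + 1) => x Dx; rewrite -(gE x Dx : _ = partial i f x).
  by apply: gM; [rewrite ltrDl|exists x => //; exact: subset_closure].
exists (\sum_i M i ^+ 2) => x Dx; apply: ler_sum => i _.
rewrite !mxE -expr2 -(real_normK (num_real _)) lerXn2r ?nnegrE ?fM//.
exact: le_trans (fM i x Dx).
Qed.

Lemma grad_linear D (s : R) f g x : C1_on D f -> C1_on D g -> D x ->
  grad (s *: f + g) x = s *: grad f x + grad g x.
Proof.
move=> [_ fd _] [_ gd _] Dx; apply/rowP => i; rewrite !mxE /partial.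
rewrite deriveD; [|by apply: derivableZ; exact: fd|exact: gd].
by rewrite deriveZ//; exact: fd.
Qed.

End BoundedGradient.

Section PerpForm.
Context {R : realType} (Omega : set 'rV[R]_3) (w : 'rV[R]_3 -> 'rV[R]_3).
Hypothesis Omega_open : open Omega.
Hypothesis Omega_bounded : bounded_set Omega.
Hypothesis w_C1 : forall i, C1_on Omega (component i w).
Hypothesis w_neq0 : forall x, Omega x -> w x != 0.
Implicit Types u v : C10 Omega.

Let integrand u v x : R := dotv (grad_perp w u x) (grad_perp w v x).

Lemma C10_Ck u : Ck_closure 1 Omega u.
Proof. by have := C10_funP u; rewrite inE => -[]. Qed.

Lemma C10_C1 u : C1_on Omega u.
Proof. exact: Ck_closure_C1_on (C10_Ck u). Qed.

Lemma C10_eq0 u x : ~ Omega x -> u x = 0.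
Proof. by have := C10_funP u; rewrite inE => -[_]; apply. Qed.

Let integrand_continuous u v x : Omega x -> {for x, continuous (integrand u v)}.
Proof.
exact: continuous_grad_perp_dot w_C1 w_neq0 Omega_open (C10_C1 u) (C10_C1 v).
Qed.

(** The field [w] may vanish on the boundary, where the orthogonal gradient need
not extend continuously; it stays bounded since it is a projection of the
gradient. *)
Let integrand_bounded u v : exists M, forall x, Omega x -> `|integrand u v x| <= M.
Proof.
have [M uM] := Ck_closure_gradient_bounded Omega_bounded (C10_Ck u).
have [N vN] := Ck_closure_gradient_bounded Omega_bounded (C10_Ck v).
exists ((M + N) / 2) => x Ox; rewrite (le_trans (dotv_young _ _))//.
rewrite ler_pM2r ?invr_gt0// lerD// (le_trans (grad_perp_le _ (w_neq0 Ox)))//.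
  exact: uM.
exact: vN.
Qed.

Let integrand_linear (s : R) u u' v x : Omega x ->
  integrand (s *: u + u') v x = s * integrand u v x + integrand u' v x.
Proof.
move=> Ox; rewrite /integrand !grad_perp_dotE ?w_neq0//.
rewrite (grad_linear s (C10_C1 u) (C10_C1 u') Ox).
rewrite (dotvC (_ + _)) !(dotvDr, dotvZr) -!(dotvC (grad v x)).
by ring.
Qed.

Lemma perp_formC u v : perp_form Omega w u v = perp_form Omega w v u.
Proof. by apply: eq_vol_int => x _; rewrite dotvC. Qed.

Lemma perp_form_linear (s : R) u u' v :
  perp_form Omega w (s *: u + u') v =
  s * perp_form Omega w u v + perp_form Omega w u' v.
Proof.
have [M uM] := integrand_bounded u v; have [N uN] := integrand_bounded u' v.
rewrite -(vol_int_linear s Omega_open Omega_bounded _ uM _ uN).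
- by apply: eq_vol_int => x Ox; exact: integrand_linear.
- exact: integrand_continuous.
- exact: integrand_continuous.
Qed.

Lemma perp_form_gt0 u : (forall x, Omega x -> helicity w x != 0) ->
  u != 0 -> 0 < perp_form Omega w u u.
Proof.
move=> h_neq0 u0; rewrite lt_neqAle eq_sym andbC vol_int_ge0 /=; last first.
  by move=> x _; exact: dotv_ge0.
apply: contra u0 => /eqP Iu.
have [M uM] := integrand_bounded u u.
have int0 := vol_int_eq0 Omega_open Omega_bounded
  (@integrand_continuous u u) uM (fun x _ => dotv_ge0 _) Iu.
have gp0 x : Omega x -> grad_perp w u x = 0 by move=> Ox; exact/dotv_eq0/int0.
have gu0 := grad_perp_eq0 Omega_open (C10_C1 u) w_C1 w_neq0 h_neq0 gp0.
apply/eqP/val_inj; apply: (const_gradient_eq0 Omega_open Omega_bounded) => //.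
- by have [] := C10_Ck u.
- exact: C10_eq0.
- exact: C10_C1.
Qed.

End PerpForm.

Lemma inner_product_is_norm (R : realType) (V : lmodType R) (B : V -> V -> R) :
  is_inner_product B -> is_norm (fun u => Num.sqrt (B u u)).
Proof.
move=> [D DB]; have NE u : Num.sqrt (B u u) = form_norm D u by rewrite /form_norm DB.
split=> [u|u|a u|u v]; rewrite ?NE.
- exact: form_norm_ge0.
- exact: form_norm_eq0.
- exact: form_normZ.
- exact: form_normD.
Qed.

Theorem mainTheorem1 (R : realType) (Omega : set 'rV[R]_3)
    (w : 'rV[R]_3 -> 'rV[R]_3)
    (Omega_domain : smoothly_bounded_domain Omega)
    (w_smooth : smooth_field_closure Omega w)
    (w_neq0 : forall x, Omega x -> w x != 0)
    (h_neq0 : forall x, Omega x -> helicity w x != 0) :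
  (is_inner_product (fun u v : C10 Omega => perp_form Omega w u v) /\
   is_norm (fun u : C10 Omega => perp_norm Omega w u)) /\
  (is_prehilbert (fun u : C10 Omega => perp_norm Omega w u)
                 (fun u v : C10 Omega => perp_form Omega w u v) /\
   exists (H : completeNormedModType R) (BH : H -> H -> R)
          (iota : {linear C10 Omega -> H}),
     is_hilbert_completion (fun u v : C10 Omega => perp_form Omega w u v)
                           BH iota).
Proof.
have [_ Oopen _ Obnd _] := Omega_domain.
have wC i : C1_on Omega (component i w) := Ck_closure_C1_on Oopen (w_smooth 1 i).
have inner : is_inner_product (fun u v : C10 Omega => perp_form Omega w u v).
  apply: is_inner_productP => [u v|s u u' v|u u0].
  - exact: perp_formC.
  - exact: perp_form_linear.
  - exact: perp_form_gt0.
split; split => //; first exact: inner_product_is_norm inner.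
have [D DB] := inner.
exists (completion D), (@polar R _ D), (@riesz R _ D).
have [pre iso den] := hilbert_completion D.
by split => // u v; rewrite iso DB.
Qed.
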